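(* Let $0<\alpha<1$, $\beta\in(0,1]$, $\gamma\in(1,2]$, $a<b$, $T>0$, let $d_\pm,e_\pm$ be non-negative real functions on $[a,b]\times[0,T]$, let $f$ and $\phi$ be given, and let $u$ be an exact solution of the space-time fractional advection-diffusion initial-boundary value problem described in the context. For integers $m\ge2$, $n\ge1$ let $u_i^{(k)}$ be the solution of the implicit difference method described in the context, let $\psi_i^{(k)}=u(x_i,t_k)-u_i^{(k)}$ and $\Psi^{(k)}=(\psi_1^{(k)},\dots,\psi_{m-1}^{(k)})^\top$. Assume that the local truncation errors $R_i^{(k+1)}$ defined in the context satisfy $R_i^{(k+1)}=\mathcal{O}(\tau^2+\tau^\alpha h)$ uniformly, i.e. there is a constant $C_0>0$, independent of $m,n,i,k$, with $|R_i^{(k+1)}|\le C_0(\tau^2+\tau^\alpha h)$ for all $1\le i\le m-1$, $0\le k\le n-1$. Then there is a constant $C$, independent of $m,n,k$, such that $$\|\Psi^{(k+1)}\|_\infty\le C\,a_k^{-1}\,(\tau^2+\tau^\alpha h),\qquad k=0,\dots,n-1 .$$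
   Context: The problem. $u$ satisfies, for $a<x<b$, $0<t\le T$, $$\frac{\partial^\alpha u}{\partial t^\alpha}=-d_+D^\beta_{a,x}u-d_-D^\beta_{x,b}u+e_+D^\gamma_{a,x}u+e_-D^\gamma_{x,b}u+f,$$ with coefficients $d_\pm(x,t),e_\pm(x,t)$ and source $f(x,t)$, $u(x,0)=\phi(x)$ for $a\le x\le b$, and $u(a,t)=u(b,t)=0$ for $0<t\le T$. Here the time derivative is the Caputo derivative $\frac{\partial^\alpha u(x,t)}{\partial t^\alpha}=\frac1{\Gamma(1-\alpha)}\int_0^t\frac{\partial u(x,s)}{\partial s}\frac{ds}{(t-s)^\alpha}$, and for order $\theta$ with integer $p$, $p-1<\theta\le p$, the Riemann-Liouville derivatives are $D^\theta_{a,x}u=\frac1{\Gamma(p-\theta)}\frac{\partial^p}{\partial x^p}\int_a^x\frac{u(s,t)}{(x-s)^{\theta-p+1}}ds$ and $D^\theta_{x,b}u=\frac{(-1)^p}{\Gamma(p-\theta)}\frac{\partial^p}{\partial x^p}\int_x^b\frac{u(s,t)}{(s-x)^{\theta-p+1}}ds$ (for integer $\theta=p$ these are understood as the classical derivatives $\frac{\partial^p u}{\partial x^p}$ and $(-1)^p\frac{\partial^p u}{\partial x^p}$). Notation. $h=(b-a)/m$, $\tau=T/n$, $x_i=a+ih$ ($0\le i\le m$), $t_j=j\tau$ ($0\le j\le n$). $d_{\pm,i}^{(j)}=d_\pm(x_i,t_j)$, $e_{\pm,i}^{(j)}=e_\pm(x_i,t_j)$, $f_i^{(j)}=f(x_i,t_j)$.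 $a_0=1$ and $a_j=(j+1)^{1-\alpha}-j^{1-\alpha}$. For $\theta\in\{\beta,\gamma\}$: $g_0^{(\theta)}=1$, $g_j^{(\theta)}=\frac{(-1)^j}{j!}\theta(\theta-1)\cdots(\theta-j+1)$ for $j\ge1$. $\omega_1=\Gamma(2-\alpha)\tau^\alpha/h^\beta$, $\omega_2=\Gamma(2-\alpha)\tau^\alpha/h^\gamma$, $\omega_3=\Gamma(2-\alpha)\tau^\alpha$. For a grid function $v_i^{(k)}$ ($0\le i\le m$, $0\le k\le n$) write $$(Lv)_i^{(k+1)}=v_i^{(k+1)}+\omega_1\Big(d_{+,i}^{(k+1)}\sum_{j=0}^{i}g_j^{(\beta)}v_{i-j}^{(k+1)}+d_{-,i}^{(k+1)}\sum_{j=0}^{m-i}g_j^{(\beta)}v_{i+j}^{(k+1)}\Big)-\omega_2\Big(e_{+,i}^{(k+1)}\sum_{j=0}^{i+1}g_j^{(\gamma)}v_{i-j+1}^{(k+1)}+e_{-,i}^{(k+1)}\sum_{j=0}^{m-i+1}g_j^{(\gamma)}v_{i+j-1}^{(k+1)}\Big).$$ The implicit difference method: $(Lu)_i^{(k+1)}=u_i^{(k)}-\sum_{j=1}^{k}a_j(u_i^{(k-j+1)}-u_i^{(k-j)})+\omega_3f_i^{(k+1)}$ for $1\le i\le m-1$, $0\le k\le n-1$ (empty sum for $k=0$), with $u_i^{(0)}=\phi(x_i)$ for $0\le i\le m$ and $u_0^{(k)}=u_m^{(k)}=0$ for $1\le k\le n$. Local truncation errors: $R_i^{(k+1)}=(L\psi)_i^{(k+1)}-\psi_i^{(k)}+\sum_{j=1}^{k}a_j(\psi_i^{(k-j+1)}-\psi_i^{(k-j)})$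 for $1\le i\le m-1$, $0\le k\le n-1$, where $\psi_i^{(k)}=u(x_i,t_k)-u_i^{(k)}$ for $0\le i\le m$; in particular $\Psi^{(0)}=0$. $\|\cdot\|_\infty$ is the maximum norm. *)

(* Defs.v *)
From mathcomp Require Import all_boot all_order all_algebra.
From mathcomp Require Import all_classical all_reals all_analysis.

Set Implicit Arguments.
Unset Strict Implicit.
Unset Printing Implicit Defensive.

Import Order.TTheory GRing.Theory Num.Theory.
Import numFieldNormedType.Exports.

Local Open Scope classical_set_scope.
Local Open Scope ring_scope.

(** Space-time fractional advection-diffusion equation, over an arbitrary
    [R : realType].  Functions of space and time are total maps
    [w : R -> R -> R], written [w x t]; only their values for [x] in [[a, b]]
    and [t] in [[0, T]] matter.  Integrals are Lebesgue integrals. *)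

Section FractionalDerivatives.
Context {R : realType}.
Local Notation mu := (@lebesgue_measure R).

(* Euler's Gamma function; the integral converges for [0 < z]. *)
Definition Gamma (z : R) : R :=
  \int[mu]_(s in `]0, +oo[) (s `^ (z - 1) * expR (- s)).

(* [derive1n] and [Rintegral] are total operators, so each fractional
   derivative comes with a predicate saying that it really exists. *)
Definition times_derivable (p : nat) (w : R -> R) (A : set R) : Prop :=
  forall k : nat, (k < p)%N -> forall x, A x -> derivable (derive1n k w) x 1.

Definition caputo_kernel (alpha : R) (w : R -> R) (t s : R) : R :=
  derive1 w s / (t - s) `^ alpha.

Definition caputo (alpha : R) (w : R -> R) (t : R) : R :=
  (Gamma (1 - alpha))^-1 * \int[mu]_(s in `]0, t[) caputo_kernel alpha w t s.

Definition caputo_exists (alpha : R) (w : R -> R) (t : R) : Prop :=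
  (times_derivable 1 w `]0, t[) /\
  mu.-integrable `]0, t[ (EFin \o caputo_kernel alpha w t).

(* The integer [p] with [p - 1 < theta <= p], for [0 < theta]. *)
Definition rl_order (theta : R) : nat := `|Num.ceil theta|%N.

Definition rl_left_kernel (theta : R) (w : R -> R) (x s : R) : R :=
  w s / (x - s) `^ (theta - (rl_order theta)%:R + 1).

Definition rl_left_integral (theta a : R) (w : R -> R) (x : R) : R :=
  \int[mu]_(s in `]a, x[) rl_left_kernel theta w x s.

Definition rl_left (theta a : R) (w : R -> R) (x : R) : R :=
  let p := rl_order theta in
  if theta == p%:R then derive1n p w x
  else (Gamma (p%:R - theta))^-1 * derive1n p (rl_left_integral theta a w) x.

Definition rl_left_exists (theta a b : R) (w : R -> R) : Prop :=
  let p := rl_order theta in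
  if theta == p%:R then times_derivable p w `]a, b[
  else (forall x, a < x < b ->
          mu.-integrable `]a, x[ (EFin \o rl_left_kernel theta w x)) /\
       times_derivable p (rl_left_integral theta a w) `]a, b[.

Definition rl_right_kernel (theta : R) (w : R -> R) (x s : R) : R :=
  w s / (s - x) `^ (theta - (rl_order theta)%:R + 1).

Definition rl_right_integral (theta b : R) (w : R -> R) (x : R) : R :=
  \int[mu]_(s in `]x, b[) rl_right_kernel theta w x s.

Definition rl_right (theta b : R) (w : R -> R) (x : R) : R :=
  let p := rl_order theta in
  if theta == p%:R then (-1) ^+ p * derive1n p w x
  else (-1) ^+ p / Gamma (p%:R - theta) * derive1n p (rl_right_integral theta b w) x.

Definition rl_right_exists (theta a b : R) (w : R -> R) : Prop :=
  let p := rl_order theta in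
  if theta == p%:R then times_derivable p w `]a, b[
  else (forall x, a < x < b ->
          mu.-integrable `]x, b[ (EFin \o rl_right_kernel theta w x)) /\
       times_derivable p (rl_right_integral theta b w) `]a, b[.

End FractionalDerivatives.

Definition exact_solution (R : realType) (alpha beta gamma a b T : R)
    (dp dm ep em f : R -> R -> R) (phi : R -> R) (u : R -> R -> R) : Prop :=
  [/\ (forall x t, a < x < b -> 0 < t <= T -> caputo_exists alpha (u x) t),
      (forall t, 0 < t <= T ->
         [/\ rl_left_exists beta a b (u ^~ t),
             rl_right_exists beta a b (u ^~ t),
             rl_left_exists gamma a b (u ^~ t) &
             rl_right_exists gamma a b (u ^~ t)]),
      (forall x t, a < x < b -> 0 < t <= T ->
         caputo alpha (u x) t =
           - dp x t * rl_left beta a (u ^~ t) x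
           - dm x t * rl_right beta b (u ^~ t) x
           + ep x t * rl_left gamma a (u ^~ t) x
           + em x t * rl_right gamma b (u ^~ t) x
           + f x t),
      (forall x, a <= x <= b -> u x 0 = phi x) &
      (forall t, 0 < t <= T -> u a t = 0 /\ u b t = 0)].

(** A grid function is [v : nat -> nat -> R], with [v i k] standing for
    v_i^(k); only [i <= m] and [k <= n] matter. *)

Definition hstep (R : realType) (a b : R) (m : nat) : R := (b - a) / m%:R.

Definition tstep (R : realType) (T : R) (n : nat) : R := T / n%:R.

Definition xnode (R : realType) (a b : R) (m i : nat) : R :=
  a + i%:R * hstep a b m.

Definition tnode (R : realType) (T : R) (n j : nat) : R := j%:R * tstep T n.

Definition acoef (R : realType) (alpha : R) (j : nat) : R :=
  if j is 0%N then 1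
  else j.+1%:R `^ (1 - alpha) - j%:R `^ (1 - alpha).

Definition gcoef (R : realType) (theta : R) (j : nat) : R :=
  (-1) ^+ j / j`!%:R * \prod_(l < j) (theta - l%:R).

Section DifferenceScheme.
Context {R : realType}.

(* [(Lv)_i^(k)], meant for [1 <= i <= m - 1]: the indices [i - j], [i + 1 - j]
   and [i + j - 1] below are then never truncated. *)
Definition scheme_op (alpha beta gamma a b T : R) (dp dm ep em : R -> R -> R)
    (m n : nat) (v : nat -> nat -> R) (i k : nat) : R :=
  let h := hstep a b m in
  let tau := tstep T n in
  let x := xnode a b m i in
  let t := tnode T n k in
  let omega1 := Gamma (2 - alpha) * tau `^ alpha / h `^ beta in
  let omega2 := Gamma (2 - alpha) * tau `^ alpha / h `^ gamma in
  v i k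
  + omega1 * (dp x t * (\sum_(0 <= j < i.+1) gcoef beta j * v (i - j)%N k)
            + dm x t * (\sum_(0 <= j < (m - i).+1)
                           gcoef beta j * v (i + j)%N k))
  - omega2 * (ep x t * (\sum_(0 <= j < i.+2) gcoef gamma j * v (i.+1 - j)%N k)
            + em x t * (\sum_(0 <= j < (m - i).+2)
                           gcoef gamma j * v (i + j).-1 k)).

Definition memory_sum (alpha : R) (v : nat -> nat -> R) (i k : nat) : R :=
  \sum_(1 <= j < k.+1) acoef alpha j * (v i (k - j).+1 - v i (k - j)%N).

Definition scheme_solution (alpha beta gamma a b T : R)
    (dp dm ep em f : R -> R -> R) (phi : R -> R) (m n : nat)
    (v : nat -> nat -> R) : Prop :=
  [/\ (forall i k : nat, (1 <= i <= m.-1)%N -> (k < n)%N ->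
         scheme_op alpha beta gamma a b T dp dm ep em m n v i k.+1 =
           v i k - memory_sum alpha v i k
           + Gamma (2 - alpha) * tstep T n `^ alpha
             * f (xnode a b m i) (tnode T n k.+1)),
      (forall i : nat, (i <= m)%N -> v i 0%N = phi (xnode a b m i)) &
      (forall k : nat, (1 <= k <= n)%N -> v 0%N k = 0 /\ v m k = 0)].

Definition grid_error (a b T : R) (u : R -> R -> R) (m n : nat)
    (v : nat -> nat -> R) (i k : nat) : R :=
  u (xnode a b m i) (tnode T n k) - v i k.

(* The vector [(psi_1^(k), ..., psi_(m-1)^(k))^T]; the norm [`|_|] of
   MathComp-Analysis on matrices is the maximum norm. *)
Definition error_vector (a b T : R) (u : R -> R -> R) (m n : nat)
    (v : nat -> nat -> R) (k : nat) : 'cV[R]_(m.-1) :=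
  \col_(i < m.-1) grid_error a b T u m n v i.+1 k.

(* [R_i^(k+1)] is [truncation_error ... i k]. *)
Definition truncation_error (alpha beta gamma a b T : R)
    (dp dm ep em : R -> R -> R) (u : R -> R -> R) (m n : nat)
    (v : nat -> nat -> R) (i k : nat) : R :=
  let psi := grid_error a b T u m n v in
  scheme_op alpha beta gamma a b T dp dm ep em m n psi i k.+1
  - psi i k + memory_sum alpha psi i k.

End DifferenceScheme.

(* Main.v *)
Require Import Defs.
From mathcomp Require Import all_boot all_order all_algebra.
From mathcomp Require Import all_classical all_reals all_analysis.
From mathcomp Require Import ring lra.
Import Order.TTheory GRing.Theory Num.Theory.
Import numFieldNormedType.Exports.
Local Open Scope ring_scope.

(** The argument is a discrete maximum principle in space followed by a
    discrete Gronwall induction in time.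

    Space.  The Gruenwald weights of order [beta] in (0, 1] satisfy
    [g_0 = 1], [g_j <= 0] for [j >= 1], and have nonnegative partial sums;
    those of order [gamma] in (1, 2] satisfy [g_1 < 0], [g_j >= 0] for
    [j <> 1], and their partial sums up to an index [N >= 1] are nonpositive
    ([gcoef_psum] identifies the partial sums with the weights of order one
    less, so these are all sign statements on weights).  Hence at a node where
    a nonnegative maximum of the grid function is attained, the two advection
    sums are nonnegative and the two diffusion sums are nonpositive, and so
    the operator [L] is at least the value of the function there
    ([scheme_op_ge_max]).  For a function vanishing at both ends of the grid,
    it follows that a bound on [|L v|] is also a bound on [|v|]
    ([scheme_op_bound]).

    Time.  Summation by parts rewrites the right-hand side of the scheme as
    [\sum_(j < k) (a_j - a_(j+1)) v^(k-j) + a_k v^(0)]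
    ([memory_sum_by_parts]), with nonnegative weights since [a_j] decreases
    (concavity of [x `^ (1 - alpha)]).  If [|v^(l+1)| <= B / a_l] for [l < k],
    then, since [v^(0) = 0] and [1 / a_l <= 1 / a_k], this is at most
    [(1 - a_k) * B / a_k], and adding a residual bounded by [B] gives exactly
    [B / a_k] ([scheme_stability]).  The theorem is this stability estimate
    applied to the grid error, whose residual is the truncation error. *)

(** * Signs and partial sums of the Gruenwald weights *)

Lemma gcoef0 (R : realType) (theta : R) : gcoef theta 0 = 1.
Proof. by rewrite /gcoef big_ord0 expr0 fact0 divr1 mulr1. Qed.

Lemma gcoefS (R : realType) (theta : R) (j : nat) :
  gcoef theta j.+1 = gcoef theta j * ((j%:R - theta) / j.+1%:R).
Proof.
have j1 : (j.+1%:R : R) != 0 by rewrite pnatr_eq0.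
have jf : (j`!%:R : R) != 0 by rewrite pnatr_eq0 -lt0n fact_gt0.
rewrite /gcoef big_ord_recr /= factS natrM exprS.
by field; rewrite nat1r j1 jf.
Qed.

Lemma gcoef1 (R : realType) (theta : R) : gcoef theta 1 = - theta.
Proof. by rewrite gcoefS gcoef0 sub0r divr1 mul1r. Qed.

(** [\sum_(j <= N) (-1)^j C(theta, j) = (-1)^N C(theta - 1, N)] *)
Lemma gcoef_psum (R : realType) (theta : R) (N : nat) :
  \sum_(0 <= j < N.+1) gcoef theta j = gcoef (theta - 1) N.
Proof.
(* absorption identity [C(theta, n+1) = theta / (n+1) * C(theta - 1, n)] *)
have gE n : gcoef theta n.+1 = - theta / n.+1%:R * gcoef (theta - 1) n.
  elim: n => [|n IHn]; first by rewrite gcoef1 gcoef0 divr1 mulr1.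
  rewrite gcoefS IHn [in RHS]gcoefS -!natr1.
  have n1 : (n%:R + 1 : R) != 0 by rewrite natr1 pnatr_eq0.
  have n2 : (n%:R + 1 + 1 : R) != 0 by rewrite !natr1 pnatr_eq0.
  by field; rewrite n1 n2.
elim: N => [|N IHN]; first by rewrite big_nat1 !gcoef0.
rewrite big_nat_recr //= IHN gE gcoefS -natr1.
have n1 : (N%:R + 1 : R) != 0 by rewrite natr1 pnatr_eq0.
by field.
Qed.

Lemma gcoef_nonpos_order_ge0 (R : realType) (theta : R) (j : nat) :
  theta <= 0 -> 0 <= gcoef theta j.
Proof.
move=> th0; elim: j => [|j IHj]; first by rewrite gcoef0.
by rewrite gcoefS mulr_ge0 // divr_ge0 // subr_ge0 (le_trans th0).
Qed.

Lemma gcoef_le0 (R : realType) (theta : R) (j : nat) :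
  0 <= theta <= 1 -> gcoef theta j.+1 <= 0.
Proof.
move=> /andP[th0 th1]; elim: j => [|j IHj]; first by rewrite gcoef1 oppr_le0.
rewrite gcoefS mulr_le0_ge0 // divr_ge0 // subr_ge0 (le_trans th1) //.
by rewrite ler1n.
Qed.

Lemma gcoef_ge0 (R : realType) (theta : R) (j : nat) :
  1 <= theta <= 2 -> 0 <= gcoef theta j.+2.
Proof.
move=> /andP[th1 th2]; elim: j => [|j IHj].
  by rewrite gcoefS gcoef1; apply: mulr_le0; lra.
rewrite gcoefS mulr_ge0 // divr_ge0 // subr_ge0 (le_trans th2) //.
by rewrite ler_nat.
Qed.

(** Here [w 0] is the value at the maximum point and [w 1], [w 2], etc. are
    the values at the successive nodes on one side of it. *)
Lemma gcoef_advection_ge0 (R : realType) (beta : R) (w : nat -> R) (N : nat) :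
  0 <= beta <= 1 -> 0 <= w 0%N -> (forall j, (j <= N)%N -> w j <= w 0%N) ->
  0 <= \sum_(0 <= j < N.+1) gcoef beta j * w j.
Proof.
move=> hb w0 wle; have hb1 : beta - 1 <= 0 by lra.
apply: (@le_trans _ _ (\sum_(0 <= j < N.+1) gcoef beta j * w 0%N)).
  by rewrite -mulr_suml gcoef_psum mulr_ge0 // gcoef_nonpos_order_ge0.
apply: ler_sum_nat => -[//|j] /= jN.
by rewrite ler_wnM2l ?gcoef_le0 // wle.
Qed.

(** The shift by one node in the diffusion sums makes the weight of index 1
    fall on the maximum point. *)
Lemma gcoef_diffusion_le0 (R : realType) (gamma : R) (w : nat -> R) (N : nat) :
  1 <= gamma <= 2 -> 0 <= w 1%N -> (forall j, (j <= N.+1)%N -> w j <= w 1%N) ->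
  \sum_(0 <= j < N.+2) gcoef gamma j * w j <= 0.
Proof.
move=> hg w1 wle; have hg1 : 0 <= gamma - 1 <= 1 by lra.
apply: (@le_trans _ _ (\sum_(0 <= j < N.+2) gcoef gamma j * w 1%N)).
  apply: ler_sum_nat => -[|[|j]] //= jN.
    by rewrite gcoef0 !mul1r wle.
  by rewrite ler_wpM2l ?gcoef_ge0 // wle.
by rewrite -mulr_suml gcoef_psum mulr_le0_ge0 // gcoef_le0.
Qed.

(** * The discrete maximum principle *)

Lemma interior_ltn (m i : nat) : (1 <= i <= m.-1)%N -> (i < m)%N.
Proof. by case: m => [|m] /andP[]; first by case: i. Qed.

Lemma Gamma_ge0 (R : realType) (z : R) : 0 <= Gamma z.
Proof.
by apply: Rintegral_ge0 => s _; rewrite mulr_ge0 ?powR_ge0 ?expR_ge0.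
Qed.

Lemma scheme_op_ge_max (R : realType) (alpha beta gamma a b T : R)
    (dp dm ep em : R -> R -> R) (m n : nat) (v : nat -> nat -> R) (i k : nat) :
  0 <= beta <= 1 -> 1 <= gamma <= 2 ->
  [/\ 0 <= dp (xnode a b m i) (tnode T n k),
      0 <= dm (xnode a b m i) (tnode T n k),
      0 <= ep (xnode a b m i) (tnode T n k) &
      0 <= em (xnode a b m i) (tnode T n k)] ->
  (1 <= i <= m.-1)%N -> 0 <= v i k ->
  (forall j, (j <= m)%N -> v j k <= v i k) ->
  v i k <= scheme_op alpha beta gamma a b T dp dm ep em m n v i k.
Proof.
move=> hb hg [dp0 dm0 ep0 em0] /interior_ltn im v0 vle; rewrite /scheme_op.
set o1 := _ / _ `^ beta; set o2 := _ / _ `^ gamma.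
have o10 : 0 <= o1 by rewrite !mulr_ge0 ?Gamma_ge0 ?invr_ge0 ?powR_ge0.
have o20 : 0 <= o2 by rewrite !mulr_ge0 ?Gamma_ge0 ?invr_ge0 ?powR_ge0.
rewrite -addrA lerDl subr_ge0 (@le_trans _ _ 0) //.
  apply: mulr_ge0_le0 => //.
  rewrite -[leRHS]addr0; apply: lerD; apply: mulr_ge0_le0 => //.
    apply: (@gcoef_diffusion_le0 _ _ (fun j => v (i.+1 - j)%N k)) => //=.
      by rewrite subn1.
    by move=> j _; rewrite subn1 vle // (leq_trans (leq_subr _ _)).
  apply: (@gcoef_diffusion_le0 _ _ (fun j => v (i + j).-1 k)) => //=.
    by rewrite addn1.
  move=> j ji; rewrite addn1 vle // -subn1 leq_subLR add1n.
  by rewrite -(subnKC (ltnW im)) -addnS leq_add2l.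
apply: mulr_ge0 => //; apply: addr_ge0; apply: mulr_ge0 => //.
  apply: (@gcoef_advection_ge0 _ _ (fun j => v (i - j)%N k)) => //=.
    by rewrite subn0.
  by move=> j _; rewrite subn0 vle // (leq_trans (leq_subr _ _)) // ltnW.
apply: (@gcoef_advection_ge0 _ _ (fun j => v (i + j)%N k)) => //=.
  by rewrite addn0.
by move=> j ji; rewrite addn0 vle // -leq_subRL // ltnW.
Qed.

Lemma scheme_opN (R : realType) (alpha beta gamma a b T : R)
    (dp dm ep em : R -> R -> R) (m n : nat) (v : nat -> nat -> R) (i k : nat) :
  scheme_op alpha beta gamma a b T dp dm ep em m n (fun i k => - v i k) i k =
  - scheme_op alpha beta gamma a b T dp dm ep em m n v i k.
Proof.
rewrite /scheme_op.
have sN N (g w : nat -> R) :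
    \sum_(0 <= j < N) g j * - w j = - \sum_(0 <= j < N) g j * w j.
  by rewrite -sumrN; apply: eq_bigr => j _; rewrite mulrN.
by rewrite !sN; ring.
Qed.

Lemma scheme_op_bound (R : realType) (alpha beta gamma a b T : R)
    (dp dm ep em : R -> R -> R) (m n : nat) (v : nat -> nat -> R) (k : nat)
    (M : R) :
  0 <= beta <= 1 -> 1 <= gamma <= 2 -> 0 <= M ->
  (forall i, (1 <= i <= m.-1)%N ->
    [/\ 0 <= dp (xnode a b m i) (tnode T n k),
        0 <= dm (xnode a b m i) (tnode T n k),
        0 <= ep (xnode a b m i) (tnode T n k) &
        0 <= em (xnode a b m i) (tnode T n k)]) ->
  v 0%N k = 0 -> v m k = 0 ->
  (forall i, (1 <= i <= m.-1)%N ->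
    `|scheme_op alpha beta gamma a b T dp dm ep em m n v i k| <= M) ->
  forall i, (i <= m)%N -> `|v i k| <= M.
Proof.
move=> hb hg M0 hc v0 vm hL i im.
pose w (l : 'I_m.+1) : R := `|v l k|.
case: (arg_maxP (i0 := ord0) (P := xpredT) w isT) => l _ lmax.
have {}lmax j : (j <= m)%N -> `|v j k| <= `|v l k|.
  by move=> jm; apply: (lmax (Ordinal (jm : (j < m.+1)%N))).
apply: (le_trans (lmax i im)).
have [l0|l0] := eqVneq (l : nat) 0%N; first by rewrite l0 v0 normr0.
have [lm|lm] := eqVneq (l : nat) m; first by rewrite lm vm normr0.
have lint : (1 <= l <= m.-1)%N.
  have lltm : (l < m)%N by rewrite ltn_neqAle lm -ltnS ltn_ord.
  by apply/andP; split; [rewrite lt0n | rewrite -ltnS (ltn_predK lltm)].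
apply: le_trans (hL l lint).
have [vl0|vl0] := leP 0 (v l k).
  rewrite {1}ger0_norm //; apply: le_trans (ler_norm _).
  apply: scheme_op_ge_max => //; first exact: hc.
  by move=> j /lmax; rewrite (ger0_norm vl0); apply/le_trans/ler_norm.
rewrite {1}ltr0_norm // -normrN -scheme_opN; apply: le_trans (ler_norm _).
apply: (@scheme_op_ge_max _ _ _ _ _ _ _ _ _ _ _ _ _ (fun i k => - v i k)) => //.
- exact: hc.
- by rewrite oppr_ge0 ltW.
- move=> j /lmax; rewrite (ltr0_norm vl0); apply: le_trans.
  by rewrite -normrN ler_norm.
Qed.

(** * The time weights *)

Lemma powR_midpoint_concave (R : realType) (p x y : R) :
  0 < p <= 1 -> 0 <= x -> 0 <= y ->
  (x `^ p + y `^ p) / 2 <= ((x + y) / 2) `^ p.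
Proof.
move=> /andP[p0 p1] x0 y0.
have q1 : 1 <= p^-1 by rewrite invf_ge1.
have powK z : 0 <= z -> (z `^ p) `^ p^-1 = z.
  by move=> z0; rewrite -powRrM divff ?gt_eqF // powRr1.
(* midpoint convexity of the inverse function, the power of exponent 1/p *)
have conv (X Y : R) : 0 <= X -> 0 <= Y ->
    ((X + Y) / 2) `^ p^-1 <= (X `^ p^-1 + Y `^ p^-1) / 2.
  move=> X0 Y0.
  have h0 : (0 : R) <= 2^-1 by lra.
  have h1 : (2^-1 : R) <= 1 by lra.
  have c : (2^-1 * X + (1 - 2^-1) * Y) `^ p^-1 <=
      2^-1 * X `^ p^-1 + (1 - 2^-1) * Y `^ p^-1.
    by apply: (convex_powR q1 (Itv01 h0 h1)); rewrite inE /= in_itv /= andbT.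
  have half : (1 - 2^-1 : R) = 2^-1 by lra.
  by move: c; rewrite half -!mulrDr ![2^-1 * _]mulrC.
have := conv _ _ (powR_ge0 x p) (powR_ge0 y p).
rewrite !powK // => h.
have m0 : 0 <= (x `^ p + y `^ p) / 2 by rewrite divr_ge0 // addr_ge0 ?powR_ge0.
have := ge0_ler_powR (ltW p0) _ _ h; rewrite !nnegrE => /(_ _ _) .
rewrite -powRrM mulVf ?gt_eqF // powRr1 //; apply.
  exact: powR_ge0.
by rewrite divr_ge0 // addr_ge0.
Qed.

(** The closed formula also covers [a_0 = 1], as [0 `^ (1 - alpha) = 0]. *)
Lemma acoefE (R : realType) (alpha : R) (j : nat) : alpha < 1 ->
  acoef alpha j = j.+1%:R `^ (1 - alpha) - j%:R `^ (1 - alpha).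
Proof.
move=> a1; case: j => [|//] /=.
by rewrite powR0 ?subr0 ?powR1 // subr_eq0 gt_eqF.
Qed.

Lemma acoef_gt0 (R : realType) (alpha : R) (j : nat) : alpha < 1 ->
  0 < acoef alpha j.
Proof.
move=> a1; rewrite acoefE // subr_gt0.
by rewrite gt0_ltr_powR ?subr_gt0 ?nnegrE ?ltr_nat.
Qed.

Lemma acoefS_le (R : realType) (alpha : R) (j : nat) : 0 <= alpha < 1 ->
  acoef alpha j.+1 <= acoef alpha j.
Proof.
move=> /andP[a0 a1]; rewrite !acoefE //.
have hp : 0 < 1 - alpha <= 1 by lra.
have := @powR_midpoint_concave R _ j%:R j.+2%:R hp (ler0n _ _) (ler0n _ _).
have -> : (j%:R + j.+2%:R) / 2 = j.+1%:R :> R by rewrite -!natr1; field.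
by lra.
Qed.

Lemma acoef_le (R : realType) (alpha : R) (j k : nat) : 0 <= alpha < 1 ->
  (j <= k)%N -> acoef alpha k <= acoef alpha j.
Proof.
move=> ha; elim: k => [|k IHk]; first by rewrite leqn0 => /eqP->.
rewrite leq_eqVlt => /predU1P[-> //|jk].
exact: le_trans (acoefS_le _ _ _ ha) (IHk jk).
Qed.

Lemma memory_sum_by_parts (R : realType) (alpha : R) (v : nat -> nat -> R)
    (i k : nat) :
  v i k - memory_sum alpha v i k =
  \sum_(0 <= j < k) (acoef alpha j - acoef alpha j.+1) * v i (k - j)%N
  + acoef alpha k * v i 0%N.
Proof.
have := @telescope_sumr _ 0 k (fun j => acoef alpha j * v i (k - j)%N) isT.
rewrite /= subn0 subnn mul1r => /eqP; rewrite eq_sym subr_eq => /eqP ->.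
rewrite /memory_sum big_add1 /= addrA -big_split /= addrC -sumrN.
congr (_ + _); apply: eq_big_nat => j /= jk.
by rewrite subnSK //; ring.
Qed.

(** * Stability in time and convergence *)

(** The time Gronwall argument, for any grid function with zero initial and
    boundary data whose residual in the scheme is at most [B]. *)
Lemma scheme_stability (R : realType) (alpha beta gamma a b T : R)
    (dp dm ep em : R -> R -> R) (m n : nat) (v : nat -> nat -> R) (B : R) :
  0 <= alpha < 1 -> 0 <= beta <= 1 -> 1 <= gamma <= 2 -> 0 <= B ->
  (forall i k, (1 <= i <= m.-1)%N -> (k < n)%N ->
    [/\ 0 <= dp (xnode a b m i) (tnode T n k.+1),
        0 <= dm (xnode a b m i) (tnode T n k.+1),
        0 <= ep (xnode a b m i) (tnode T n k.+1) &
        0 <= em (xnode a b m i) (tnode T n k.+1)]) ->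
  (forall i, (1 <= i <= m.-1)%N -> v i 0%N = 0) ->
  (forall k, (k < n)%N -> v 0%N k.+1 = 0 /\ v m k.+1 = 0) ->
  (forall i k, (1 <= i <= m.-1)%N -> (k < n)%N ->
    `|scheme_op alpha beta gamma a b T dp dm ep em m n v i k.+1
      - v i k + memory_sum alpha v i k| <= B) ->
  forall k i, (k < n)%N -> (i <= m)%N -> `|v i k.+1| <= B / acoef alpha k.
Proof.
move=> ha hb hg B0 hc v0 vbd hres k; have a1 : alpha < 1 by lra.
elim/ltn_ind: k => k IHk i kn im.
have ak0 := acoef_gt0 _ _ k a1.
have [v0k vmk] := vbd k kn.
apply: (@scheme_op_bound _ alpha _ _ _ _ _ _ _ _ _ _ _ _ _
  (B / acoef alpha k) hb hg _ _ v0k vmk) im.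
- by rewrite divr_ge0 // ltW.
- by move=> l lm; apply: hc.
move=> {}i im; have := hres i k im kn.
set L := scheme_op _ _ _ _ _ _ _ _ _ _ _ _ _ _ _ => LB.
have -> : L = (L - v i k + memory_sum alpha v i k)
              + (v i k - memory_sum alpha v i k) by ring.
rewrite (le_trans (ler_normD _ _)) //.
rewrite (_ : B / acoef alpha k = B + (1 - acoef alpha k) * (B / acoef alpha k));
  last by field; rewrite gt_eqF.
apply: lerD => //.
rewrite memory_sum_by_parts v0 // mulr0 addr0.
(* the weights sum to [a_0 - a_k = 1 - a_k] *)
have -> : 1 - acoef alpha k =
    \sum_(0 <= j < k) (acoef alpha j - acoef alpha j.+1).
  rewrite -[RHS]opprK -sumrN.
  under eq_bigr do rewrite opprB.
  by rewrite telescope_sumr // opprB.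
rewrite mulr_suml (le_trans (ler_norm_sum _ _ _)) //.
apply: ler_sum_nat => j /= jk.
rewrite normrM ger0_norm ?subr_ge0 ?acoefS_le //.
rewrite ler_wpM2l ?subr_ge0 ?acoefS_le //.
have -> : (k - j = (k - j.+1).+1)%N by rewrite subnSK.
have lk : (k - j.+1 < k)%N by rewrite subnSK // leq_subr.
apply: le_trans (IHk _ lk i (ltn_trans lk kn) (ltnW (interior_ltn _ _ im))) _.
rewrite ler_wpM2l // lef_pV2 ?posrE ?acoef_gt0 //.
by apply: acoef_le => //; exact: ltnW.
Qed.

Theorem theorem2p3 (R : realType) (alpha beta gamma a b T : R)
    (dp dm ep em f : R -> R -> R) (phi : R -> R) (u : R -> R -> R)
    (U : nat -> nat -> nat -> nat -> R)
    (halpha : 0 < alpha < 1) (hbeta : 0 < beta <= 1) (hgamma : 1 < gamma <= 2)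
    (hab : a < b) (hT : 0 < T)
    (hcoef : forall x t : R, a <= x <= b -> 0 <= t <= T ->
       [/\ 0 <= dp x t, 0 <= dm x t, 0 <= ep x t & 0 <= em x t])
    (hu : exact_solution alpha beta gamma a b T dp dm ep em f phi u)
    (hU : forall m n : nat, (2 <= m)%N -> (1 <= n)%N ->
       scheme_solution alpha beta gamma a b T dp dm ep em f phi m n (U m n))
    (hR : exists C0 : R, 0 < C0 /\
       forall m n i k : nat, (2 <= m)%N -> (1 <= n)%N ->
         (1 <= i <= m.-1)%N -> (k < n)%N ->
         `|truncation_error alpha beta gamma a b T dp dm ep em u m n (U m n) i k|
         <= C0 * (tstep T n ^+ 2 + tstep T n `^ alpha * hstep a b m)) :
  exists C : R, forall m n k : nat, (2 <= m)%N -> (1 <= n)%N -> (k < n)%N ->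
    `|error_vector a b T u m n (U m n) k.+1|
    <= C * (acoef alpha k)^-1
       * (tstep T n ^+ 2 + tstep T n `^ alpha * hstep a b m).
Proof.
case: hR => C0 [C0pos hR]; exists C0 => m n k m2 n1 kn.
have [_ _ _ u0 ubd] := hu; have [_ U0 Ubd] := hU m n m2 n1.
have m0 : (0 : R) < m%:R by rewrite ltr0n (ltn_trans _ m2).
have n0 : (0 : R) < n%:R by rewrite ltr0n.
have xin i : (i <= m)%N -> a <= xnode a b m i <= b.
  move=> im; rewrite /xnode /hstep.
  have ba : 0 <= b - a by rewrite subr_ge0 ltW.
  have r0 : 0 <= i%:R / m%:R :> R by rewrite divr_ge0.
  have r1 : i%:R / m%:R <= 1 :> R by rewrite ler_pdivrMr // mul1r ler_nat.
  have -> : i%:R * ((b - a) / m%:R) = i%:R / m%:R * (b - a) :> R by ring.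
  by nra.
have tin j : (j < n)%N -> 0 < tnode T n j.+1 <= T.
  move=> jn; rewrite /tnode /tstep.
  have -> : j.+1%:R * (T / n%:R) = j.+1%:R / n%:R * T :> R by ring.
  rewrite pmulr_lgt0 // divr_gt0 ?ltr0n //=.
  by rewrite ler_piMl ?(ltW hT) // ler_pdivrMr // mul1r ler_nat.
have x0 : xnode a b m 0 = a by rewrite /xnode mul0r addr0.
have xm : xnode a b m m = b.
  by rewrite /xnode /hstep mulrC divfK ?gt_eqF // addrC subrK.
set E := (X in _ <= _ * X).
have E0 : 0 <= E.
  rewrite addr_ge0 ?sqr_ge0 // mulr_ge0 ?powR_ge0 //.
  by rewrite divr_ge0 // subr_ge0 ltW.
have ak0 : 0 < acoef alpha k by apply: acoef_gt0; lra.
have stab : forall i, (i <= m)%N ->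
    `|grid_error a b T u m n (U m n) i k.+1| <= C0 * E / acoef alpha k.
  move=> i; apply: (@scheme_stability _ alpha beta gamma a b T dp dm ep em m n)
    kn; try lra.
  - by rewrite mulr_ge0 // ltW.
  - move=> {}i j im jn; apply: hcoef.
      by apply/xin/ltnW/interior_ltn.
    by have /andP[/ltW-> ->] := tin j jn.
  - move=> {}i /interior_ltn/ltnW im.
    by rewrite /grid_error /tnode mul0r u0 ?xin // U0 // subrr.
  - move=> j jn; rewrite /grid_error x0 xm.
    have [-> ->] := ubd _ (tin j jn).
    by have [-> ->] := Ubd _ (jn : (1 <= j.+1 <= n)%N); rewrite subrr.
  - by move=> {}i j im jn; apply: hR.
rewrite [leLHS]mx_normrE bigmax_le //.
  by rewrite !mulr_ge0 ?invr_ge0 // ltW.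
move=> [i j] _ /=; rewrite mxE mulrAC; apply: stab.
exact: leq_trans (ltn_ord i) (leq_pred m).
Qed.
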